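(* Let $(X,\|\cdot\|)$ be an AM-space with unit, denoted by $e$, let $\psi\in(X^+)^*\setminus\{0\}$, and let $\omega$ be the seminorm $\omega(x)=\inf\{b-a\mid a,b\in\mathbb R,\ ae\le x\le be\}$ on $X$. Let $G$ be an open subset of $X$ and let $F:G\to X$ be a map such that $F|_{G\cap\psi^{-1}(0)}$ is nonexpansive with respect to $\omega$ (i.e. $\omega(F(x)-F(y))\le\omega(x-y)$ for all $x,y\in G\cap\psi^{-1}(0)$). Let $v\in G\cap\psi^{-1}(0)$ be a fixed point of $F$: $F(v)=v$. Assume: (A1) $F$ is semidifferentiable at $v$, with semidifferential $F'_v:X\to X$; (A2) the map $(\mathrm{Id}-F'_v)|_{\psi^{-1}(0)}:\psi^{-1}(0)\to X$ has Property (F); (A3) the fixed point of $F'_v$ in $\psi^{-1}(0)$ is unique: if $x\in\psi^{-1}(0)$ and $F'_v(x)=x$, then $x=0$; (A4) $F'_v$ is order preserving: $x\le y$ implies $F'_v(x)\le F'_v(y)$; (A5) $F'_v$ is additively subhomogeneous: $F'_v(x+te)\le F'_v(x)+te$ for all $x\in X$ and $t\ge0$. Then the additive eigenvector of $F$ in $G\cap\psi^{-1}(0)$ is unique: if $w\in G\cap\psi^{-1}(0)$ and $F(w)=\lambda e+w$ for some $\lambda\in\mathbb R$, then $w=v$.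
   Context: AM-space with unit: a (real) Banach lattice $(X,\|\cdot\|,\le)$ equipped with a distinguished element $e\ge0$ (the unit) such that $\|x\|=\inf\{a\ge0\mid -ae\le x\le ae\}$ for all $x\in X$ (equivalently, up to isometric lattice isomorphism, $X=\mathscr C(K)$ with the sup-norm for a compact Hausdorff space $K$, with $e$ the constant function $1$). $X^+=\{x\in X\mid x\ge0\}$, and $(X^+)^*$ is the set of continuous linear forms on $X$ that are nonnegative on $X^+$. Semidifferentiability: let $G\subset X$ and $v$ an interior point of $G$. A map $F:G\to X$ is semidifferentiable at $v$ if there exists a continuous, positively homogeneous map $h:X\to X$ (i.e. $h(tx)=th(x)$ for all $t>0$, $x\in X$) such that $F(v+x)=F(v)+h(x)+o(\|x\|)$ as $x\to0$. Such $h$ is unique and denoted $F'_v$ (the semidifferential of $F$ at $v$). Property (F): a map $g:D\to Y$, with $D\subset X$ and $X,Y$ Banach spaces, has Property (F) if every sequence $(x_j)_{j\ge1}$ in $D$ that is bounded in $X$ and satisfies $g(x_j)\to0$ has a subsequence that converges in $X$. *)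

(* Defs.v *)
From HB Require Import structures.
From mathcomp Require Import all_boot all_order all_algebra.
From mathcomp Require Import all_classical all_reals all_analysis.

Set Implicit Arguments.
Unset Strict Implicit.
Unset Printing Implicit Defensive.

Import Order.TTheory GRing.Theory Num.Theory.
Import numFieldNormedType.Exports.

Local Open Scope classical_set_scope.
Local Open Scope ring_scope.

(* A real Banach lattice.  The order is a field of the structure rather than an
   Order.Lattice instance because Hierarchy Builder rejects a join of
   Order.POrder with normed modules (the only structures it knows that extend
   both are the numeric domains).  Binary meets need not be required: the meet of x and y
   is - sup (- x) (- y). *)
HB.mixin Record isBanachLattice (R : realType) X
    of CompleteNormedModule R X := {
  bl_le : rel X ;
  bl_sup : X -> X -> X ;
  bl_le_refl : reflexive bl_le ;
  bl_le_anti : antisymmetric bl_le ;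
  bl_le_trans : transitive bl_le ;
  bl_leD2r : forall x y z : X, bl_le x y -> bl_le (x + z) (y + z) ;
  bl_leZ : forall (a : R) (x y : X), 0 <= a -> bl_le x y ->
    bl_le (a *: x) (a *: y) ;
  bl_le_sup : forall x y z : X, bl_le (bl_sup x y) z = bl_le x z && bl_le y z ;
  (* |x| <= |y| in the order implies the same for the norms, where the modulus
     |x| is the supremum of x and - x *)
  bl_le_norm : forall x y : X,
    bl_le (bl_sup x (- x)) (bl_sup y (- y)) -> `|x| <= `|y|
}.

#[short(type="banachLatticeType")]
HB.structure Definition BanachLattice (R : realType) :=
  { X of CompleteNormedModule R X & isBanachLattice R X }.

Notation "x <=B y" := (bl_le x y) (at level 70, y at next level) : ring_scope.
Notation "x <=B y <=B z" := ((x <=B y) && (y <=B z))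
  (at level 70, y, z at next level) : ring_scope.

Section AMSpace.
Context {R : realType} {X : banachLatticeType R}.

(* The real-valued inf is 0 on the empty set, but this cannot make an instance
   of the equation below true by accident: a norm equal to 0 means x = 0, and
   a = 0 is then in the set. *)
Definition is_am_unit (e : X) : Prop :=
  0 <=B e /\
  forall x : X, `|x| = inf [set a : R | 0 <= a /\ - (a *: e) <=B x <=B a *: e].

Definition positive_form (psi : {linear X -> R^o}) : Prop :=
  continuous (psi : X -> R^o) /\ forall x : X, 0 <=B x -> 0 <= psi x.

(* When e is a unit and X is not {0}, the set below is nonempty and bounded
   below by 0, so the real-valued inf is the genuine infimum. *)
Definition omega (e x : X) : R :=
  inf [set c : R | exists a b : R, a *: e <=B x <=B b *: e /\ c = b - a].

Definition nonexpansive_on (D : set X) (omega : X -> R) (F : X -> X) : Prop :=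
  forall x y : X, D x -> D y -> omega (F x - F y) <= omega (x - y).

Definition order_preserving (h : X -> X) : Prop :=
  forall x y : X, x <=B y -> h x <=B h y.

Definition additively_subhomogeneous (e : X) (h : X -> X) : Prop :=
  forall (x : X) (t : R), 0 <= t -> h (x + t *: e) <=B h x + t *: e.

End AMSpace.

Section Semidifferential.
Context {R : realType} {X : normedModType R}.

Definition positively_homogeneous (h : X -> X) : Prop :=
  forall (t : R) (x : X), 0 < t -> h (t *: x) = t *: h x.

(* h is the semidifferential at v of the map F : G -> X.  Only the values of F
   on G matter: v is interior to G, so v + x is in G for x near 0. *)
Definition is_semidifferential (G : set X) (F : X -> X) (v : X) (h : X -> X)
    : Prop :=
  [/\ interior G v,
      continuous h,
      positively_homogeneous h &
      (fun x => F (v + x) - (F v + h x)) =o_ (0 : X) id].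

End Semidifferential.

Definition property_F {R : realType} {X Y : completeNormedModType R}
    (D : set X) (g : X -> Y) : Prop :=
  forall u : nat -> X,
    (forall j, D (u j)) -> bounded_fun u -> g (u j) @[j --> \oo] --> (0 : Y) ->
    exists2 s : nat -> nat, increasing_seq s & cvgn (u \o s).

(* Main.v *)
(* Modulo the unit, [F] becomes a map [f x = F x - mu x *: e] of [psi^-1(0)]
   into itself that fixes [v] and [w] and is nonexpansive for [omega], which is
   an equivalent norm on [psi^-1(0)].  If [d = omega (w - v) > 0], then for small
   [r] the set of the [x] with [omega (x - v) <= r] and [omega (x - w) <= d - r]
   is convex and stable under [f], hence contains almost fixed points of [f];
   these lie at distance exactly [r] from [v].  Rescaling [x - v] by [r^-1] and
   letting [r] tend to [0] gives points [y] of [psi^-1(0)], bounded away from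
   [0], such that [y - F'v y + mu *: e] is small.  Order preservation and additive
   subhomogeneity force [mu] to be small as well, so Property (F) yields
   a nonzero fixed point of [F'v] in [psi^-1(0)]. *)
Require Import Defs.
From HB Require Import structures.
From mathcomp Require Import all_boot all_order all_algebra.
From mathcomp Require Import all_classical all_reals all_analysis.
From mathcomp Require Import lra.

Import Order.TTheory GRing.Theory Num.Theory.
Import numFieldNormedType.Exports.

Local Open Scope classical_set_scope.
Local Open Scope ring_scope.

Set Implicit Arguments.
Unset Strict Implicit.

#[local] Arguments bl_le_trans {R s y x z} _ _.
#[local] Arguments bl_leD2r {R s x y} z _.
#[local] Arguments bl_leZ {R s a x y} _ _.
#[local] Arguments bl_le_refl {R s x}.

(** * Almost fixed points of nonexpansive maps *)

(** Pulling [f] slightly towards [p] gives a contraction [T] of ratio [1 - t] on [S]. The steps of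
    its iteration decay geometrically, and [T] differs from [f] by at most [t * D]. Only consecutive
    iterates are compared; no limit point is taken. *)
Lemma approximate_fixed_point (R : realType) (V : lmodType R) (N : V -> R)
    (S : set V) (f : V -> V) (p : V) (D : R) :
  (forall x y, N (x + y) <= N x + N y) ->
  (forall (a : R) x, N (a *: x) = `|a| * N x) ->
  (forall x y (t : R), 0 <= t <= 1 -> S x -> S y ->
    S ((1 - t) *: x + t *: y)) ->
  (forall x, S x -> S (f x)) ->
  (forall x y, S x -> S y -> N (f x - f y) <= N (x - y)) ->
  (forall x y, S x -> S y -> N (x - y) <= D) ->
  S p ->
  forall eps : R, 0 < eps -> exists2 x, S x & N (x - f x) < eps.
Proof.
move=> ND NZ Sconv fS f_nexp S_bnd Sp eps eps0.
have D0 : 0 <= D.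
  apply: le_trans (S_bnd p p Sp Sp).
  by rewrite subrr -[0 in X in _ <= N X](scale0r p) NZ normr0 mul0r.
(* In the denominator, [D] makes [t * D < eps / 2] and [eps] makes [t < 1]. *)
pose t : R := eps / (2 * (D + 1 + eps)).
have den0 : 0 < 2 * (D + 1 + eps) by lra.
have t0 : 0 < t by rewrite divr_gt0.
have t1 : t < 1 by rewrite ltr_pdivrMr//; lra.
have tD : t * D < eps / 2.
  rewrite /t mulrAC ltr_pdivrMr//; nra.
pose T x := (1 - t) *: f x + t *: p.
pose x n := iter n T p.
have Sx n : S (x n).
  by elim: n => //= n IH; apply: Sconv; [lra | exact: fS | ].
have dx n : N (x n - x n.+1) <= (1 - t) ^+ n * D.
  elim: n => [|n IH].
    by rewrite expr0 mul1r; apply: S_bnd; [exact: (Sx 0) | exact: (Sx 1)].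
  have -> : x n.+1 - x n.+2 = (1 - t) *: (f (x n) - f (x n.+1)).
    have -> : x n.+1 - x n.+2 = T (x n) - T (x n.+1) by []; rewrite /T.
    by rewrite opprD addrACA subrr addr0 -scalerBr.
  rewrite NZ ger0_norm; last by lra.
  rewrite exprS -mulrA ler_wpM2l//; first by lra.
  exact: le_trans (f_nexp _ _ (Sx _) (Sx _)) IH.
have [n Hn] : exists n, (1 - t) ^+ n * D < eps / 2.
  have : (fun n => D * (1 - t) ^+ n) @ \oo --> (0 : R).
    by apply: cvg_geometric; rewrite ger0_norm; lra.
  move/cvgrPdist_lt => /(_ (eps / 2)); case; first by lra.
  move=> n _ /(_ n (leqnn n)) /=; rewrite sub0r normrN mulrC => H.
  by exists n; apply: le_lt_trans H; rewrite ler_norm.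
exists (x n) => //.
have -> : x n - f (x n) = (x n - x n.+1) + t *: (p - f (x n)).
  rewrite [x n.+1]/(T (x n)) /T -addrA; congr (_ + _).
  rewrite scalerBl scale1r scalerBr opprD opprB.
  by rewrite addrA subrK addrAC subrr add0r.
apply: le_lt_trans (ND _ _) _.
rewrite NZ gtr0_norm//.
have := dx n.
have : t * N (p - f (x n)) <= t * D.
  by rewrite ler_pM2l//; apply: S_bnd => //; exact: fS.
lra.
Qed.

Lemma positively_homogeneous0 {R : realType} {X : normedModType R}
    (h : X -> X) :
  positively_homogeneous h -> h 0 = 0.
Proof.
move=> hhom; have := hhom 2 0 (ltr0Sn _ 1); rewrite scaler0 scaler_nat mulr2n.
by move/eqP; rewrite -subr_eq subrr eq_sym => /eqP.
Qed.

Section BanachLatticeOrder.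
Context {R : realType} {X : banachLatticeType R}.
Implicit Types x y z : X.

Lemma bl_leD x y x' y' : x <=B y -> x' <=B y' -> x + x' <=B y + y'.
Proof.
move=> xy xy'; apply: (bl_le_trans (bl_leD2r x' xy)).
by rewrite ![y + _]addrC; exact: bl_leD2r.
Qed.

Lemma bl_leN x y : x <=B y -> - y <=B - x.
Proof.
by move=> /(@bl_leD2r _ X _ _ (- x - y));
  rewrite addrA subrr add0r addrCA subrr addr0.
Qed.

End BanachLatticeOrder.

(** * Order, norm and [omega] in an AM-space with unit *)

Section AMUnit.
Context {R : realType} {X : banachLatticeType R} {e : X}.
Hypothesis he : is_am_unit e.
Implicit Types (x y z : X) (a b c : R).

Lemma unit_leZ a b : a <= b -> a *: e <=B b *: e.
Proof.
rewrite -subr_ge0 => ab; have := bl_leZ ab he.1.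
by move/(@bl_leD2r _ X _ _ (a *: e)); rewrite scaler0 add0r -scalerDl subrK.
Qed.

Lemma norm_le_unit a x : 0 <= a -> - (a *: e) <=B x <=B a *: e -> `|x| <= a.
Proof.
move=> a0 xa; rewrite he.2; apply: ge_inf; last by [].
by exists 0 => b [].
Qed.

(** Strictness leaves room for an element of the defining set below [a], so the infimum need not be
    attained. *)
Lemma unit_bound a x : `|x| < a -> - (a *: e) <=B x <=B a *: e.
Proof.
move=> xa.
set S := [set a : R | 0 <= a /\ - (a *: e) <=B x <=B a *: e].
have [S0|S0] := pselect (S !=set0).
  have hi : has_inf S.
    by split=> //; exists 0 => b [].
  have eps0 : 0 < a - `|x| by rewrite subr_gt0.
  have [b [b0 /andP[b1 b2]]] := inf_adherent eps0 hi.
  rewrite /S -he.2 [_ + (_ - _)]addrC subrK => ba.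
  have bae := unit_leZ (ltW ba).
  by rewrite (bl_le_trans (bl_leN bae) b1) (bl_le_trans b2 bae).
(* The convention [inf set0 = 0] would force [x = 0], but then [0] belongs to [S]. *)
have x0 : x = 0.
  apply/eqP; rewrite -normr_eq0 he.2 -/S.
  by move/set0P/negP/negPn/eqP: S0 => ->; rewrite inf0.
exfalso; apply: S0; exists 0.
by split=> //; rewrite scale0r oppr0 x0 bl_le_refl.
Qed.

Lemma norm_unitZ a : `|a *: e| <= `|a|.
Proof.
apply: norm_le_unit => //; rewrite -scaleNr; apply/andP; split; apply: unit_leZ.
  by rewrite lerNl -normrN ler_norm.
exact: ler_norm.
Qed.

Context {psi : {linear X -> R^o}}.
Hypothesis hpsi : positive_form psi.
Hypothesis hpsi0 : exists x : X, psi x <> 0.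

Lemma positive_form_le x y : x <=B y -> psi x <= psi y.
Proof.
move=> /(@bl_leD2r _ X _ _ (- x)); rewrite subrr => /hpsi.2.
by rewrite linearB subr_ge0.
Qed.

Lemma positive_formZ a x : psi (a *: x) = a * psi x.
Proof. by rewrite linearZ. Qed.

(** Every [x] lies between two multiples of [e], so [psi e = 0] would make [psi] vanish. *)
Lemma positive_form_unit : 0 < psi e.
Proof.
rewrite lt_neqAle hpsi.2 ?he.1// andbT eq_sym; apply/eqP => pe0.
have [x] := hpsi0; apply.
have /andP[] := @unit_bound (`|x| + 1) x (ltr_pwDr ltr01 (lexx _)).
rewrite -scaleNr => /positive_form_le + /positive_form_le.
rewrite !positive_formZ pe0 !mulr0 => ? ?.
by apply/eqP; rewrite eq_le; apply/andP.
Qed.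

Lemma unit_leZ_inv a b : a *: e <=B b *: e -> a <= b.
Proof.
move/positive_form_le; rewrite !positive_formZ ler_pM2r//.
exact: positive_form_unit.
Qed.

Lemma omega_le a b x : a *: e <=B x <=B b *: e -> omega e x <= b - a.
Proof.
move=> xab; apply: ge_inf; last by exists a, b.
exists 0 => _ [a' [b' [/andP[h1 h2] ->]]].
by rewrite subr_ge0; apply: unit_leZ_inv; exact: bl_le_trans h1 h2.
Qed.

Lemma omega_lt c x : omega e x < c ->
  exists a b, a *: e <=B x <=B b *: e /\ b - a < c.
Proof.
move=> xc.
set S := [set c : R | exists a b : R, a *: e <=B x <=B b *: e /\ c = b - a].
have hi : has_inf S.
  split; last first.
    exists 0 => _ [a' [b' [/andP[h1 h2] ->]]].
    by rewrite subr_ge0; apply: unit_leZ_inv; exact: bl_le_trans h1 h2.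
  have := @unit_bound (`|x| + 1) x (ltr_pwDr ltr01 (lexx _)).
  rewrite -scaleNr => h.
  by exists ((`|x| + 1) - - (`|x| + 1)), (- (`|x| + 1)), (`|x| + 1).
have eps0 : 0 < c - omega e x by rewrite subr_gt0.
have [_ [a [b [ab ->]]]] := inf_adherent eps0 hi.
rewrite [_ + (_ - _)]addrC subrK => ba.
by exists a, b.
Qed.

Lemma omegaD x y : omega e (x + y) <= omega e x + omega e y.
Proof.
apply/ler_addgt0Pr => eps eps0.
have [|a [b [/andP[ax xb] ab]]] := @omega_lt (omega e x + eps / 2) x; first lra.
have [|a' [b' [/andP[ay yb] ab']]] := @omega_lt (omega e y + eps / 2) y.
  lra.
have : omega e (x + y) <= (b + b') - (a + a').
  by apply: omega_le; rewrite !scalerDl !bl_leD.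
lra.
Qed.

Lemma omegaN x : omega e (- x) = omega e x.
Proof.
suff le z : omega e (- z) <= omega e z.
  by apply/eqP; rewrite eq_le le -[in leLHS](opprK x) le.
apply/ler_addgt0Pr => eps eps0.
have [|a [b [/andP[az zb] ab]]] := @omega_lt (omega e z + eps) z; first lra.
have : omega e (- z) <= - a - - b.
  by apply: omega_le; rewrite !scaleNr !bl_leN.
lra.
Qed.

Lemma omegaZ a x : omega e (a *: x) = `|a| * omega e x.
Proof.
have omega0 : omega e 0 = 0.
  apply/eqP; rewrite eq_le; apply/andP; split.
    by have := @omega_le 0 0 0; rewrite scale0r bl_le_refl subrr; apply.
  by have := omegaD 0 0; rewrite addr0 -lerBlDr subrr.
have le c z : 0 < c -> omega e (c *: z) <= c * omega e z.
  move=> c0; rewrite -ler_pdivrMl//; apply/ler_addgt0Pr => eps eps0.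
  have [|a' [b [/andP[az zb] ab]]] := @omega_lt (omega e z + eps) z; first lra.
  have : omega e (c *: z) <= c * b - c * a'.
    by apply: omega_le; rewrite -!scalerA !bl_leZ// ltW.
  rewrite -mulrBr => h.
  by rewrite ler_pdivrMl//; apply: le_trans h _; rewrite ler_pM2l// ltW.
(* The reverse inequality is [le] for the scalar [c^-1]. *)
have eqp c z : 0 < c -> omega e (c *: z) = c * omega e z.
  move=> c0; apply/eqP; rewrite eq_le le//= -ler_pdivlMl//.
  have := le c^-1 (c *: z); rewrite scalerA mulVf ?gt_eqF// scale1r; apply.
  by rewrite invr_gt0.
have [a0|a0|->] := ltgtP a 0; last by rewrite scale0r omega0 normr0 mul0r.
  by rewrite ltr0_norm// -omegaN -scaleNr eqp// oppr_gt0.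
by rewrite gtr0_norm// eqp.
Qed.

(** This lets values of [F] be moved into [psi^-1(0)] along [e] without changing their
    [omega]-distances. *)
Lemma omegaDunit a x : omega e (x + a *: e) = omega e x.
Proof.
have omega_unit b : omega e (b *: e) <= 0.
  by have := @omega_le b b (b *: e); rewrite bl_le_refl subrr; apply.
apply/eqP; rewrite eq_le; apply/andP; split.
  have := omegaD x (a *: e); have := omega_unit a; lra.
have := omegaD (x + a *: e) (- a *: e); have := omega_unit (- a).
rewrite -addrA -scalerDl subrr scale0r addr0; lra.
Qed.

Lemma omega_le_norm x : omega e x <= 2 * `|x|.
Proof.
apply/ler_addgt0Pr => eps eps0.
have /unit_bound : `|x| < `|x| + eps / 2 by lra.
rewrite -scaleNr => /omega_le; lra.
Qed.

(** Applying [psi] to [a *: e <= x <= b *: e] gives [a <= 0 <= b], so [-a] and [b] are both at most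
    [b - a]. *)
Lemma norm_le_omega x : psi x = 0 -> `|x| <= omega e x.
Proof.
move=> x0; apply/ler_addgt0Pr => eps eps0.
have [|a [b [/andP[ax xb] ab]]] := @omega_lt (omega e x + eps) x; first lra.
have pe := positive_form_unit.
have a0 : a <= 0.
  by have := positive_form_le ax; rewrite x0 positive_formZ pmulr_lle0.
have b0 : 0 <= b.
  by have := positive_form_le xb; rewrite x0 positive_formZ pmulr_lge0.
apply: (@le_trans _ _ (b - a)); last by rewrite ltW.
apply: norm_le_unit; first lra.
rewrite -scaleNr; apply/andP; split.
  by apply: bl_le_trans ax; apply: unit_leZ; lra.
by apply: bl_le_trans xb _; apply: unit_leZ; lra.
Qed.

(* Any upper bound [b *: e] of [z] can be improved to [(b - d) *: e], for a
   fixed [d > 0], as long as [mu > eps]; but [b >= 0] because [psi z = 0]. *)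
Lemma approx_eigenvalue_le (h : X -> X) (mu eps : R) z :
  order_preserving h -> (forall b, 0 <= b -> h (b *: e) <=B b *: e) ->
  psi z = 0 -> `|z - h z + mu *: e| <= eps -> mu <= eps.
Proof.
move=> hmono hunit z0 zh; rewrite leNgt; apply/negP => eps_mu.
(* Half the gap, so that [mu - d] is still strictly above [eps], as [unit_bound] requires. *)
pose d := (mu - eps) / 2.
have d0 : 0 < d by rewrite /d; lra.
have pe := positive_form_unit.
have zle : z <=B h z - d *: e.
  have /unit_bound/andP[_] : `|z - h z + mu *: e| < mu - d.
    by rewrite /d; lra.
  move/(@bl_leD2r _ X _ _ (h z - mu *: e)).
  by rewrite addrACA subrr addr0 subrK scalerBl addrCA addrAC subrr add0r.
have step b : z <=B b *: e -> z <=B (b - d) *: e.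
  move=> zb; have b0 : 0 <= b.
    by have := positive_form_le zb; rewrite z0 positive_formZ pmulr_lge0.
  apply: bl_le_trans zle _; rewrite scalerBl; apply: bl_leD2r.
  exact: bl_le_trans (hmono _ _ zb) (hunit _ b0).
have steps n : z <=B (`|z| + 1 - n%:R * d) *: e.
  elim: n => [|n /step]; last by rewrite -addrA -opprD mulrSr mulrDl mul1r.
  rewrite mul0r subr0.
  by have /unit_bound/andP[] : `|z| < `|z| + 1 by rewrite ltrDl.
(* After this many steps the coefficient of [e] is negative. *)
have := positive_form_le (steps (Num.truncn ((`|z| + 1) / d)).+1).
rewrite z0 positive_formZ pmulr_lge0// subr_ge0 leNgt => /negP; apply.
by rewrite -ltr_pdivrMr// truncnS_gt.
Qed.

(** The lower bound on [mu] is the upper bound for the conjugate map sending [x] to [- h (- x)], at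
    the point [- z]. Subhomogeneity at [0] and at [- (b *: e)] gives the bound on multiples of [e]
    for the two maps. *)
Lemma approx_eigenvalue_small (h : X -> X) (mu eps : R) z :
  order_preserving h -> additively_subhomogeneous e h -> h 0 = 0 ->
  psi z = 0 -> `|z - h z + mu *: e| <= eps -> `|mu| <= eps.
Proof.
move=> hmono hsub h0 z0 zh.
rewrite ler_norml; apply/andP; split; last first.
  apply: approx_eigenvalue_le z0 zh => // b b0.
  by have := hsub 0 b b0; rewrite h0 !add0r.
rewrite lerNl.
apply: (@approx_eigenvalue_le (fun x => - h (- x)) _ _ (- z)).
- by move=> x y xy; apply/bl_leN/hmono/bl_leN.
- move=> b b0; have := hsub (- (b *: e)) b b0.
  rewrite addNr h0 => /(@bl_leD2r _ X _ _ (- h (- (b *: e)))).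
  by rewrite add0r addrAC subrr add0r.
- by rewrite linearN z0 oppr0.
- have -> : - z - - h (- - z) + - mu *: e = - (z - h z + mu *: e).
    by rewrite !opprK scaleNr !opprD opprK.
  by rewrite normrN.
Qed.

(** * Almost fixed unit directions of the semidifferential *)

Local Notation om := (omega e).

Lemma approx_fixed_direction (G : set X) (F h : X -> X) (v w : X) (lambda : R) :
  open G ->
  nonexpansive_on (G `&` psi @^-1` [set 0]) (omega e) F ->
  (G `&` psi @^-1` [set 0]) v -> F v = v ->
  is_semidifferential G F v h ->
  order_preserving h -> additively_subhomogeneous e h ->
  (G `&` psi @^-1` [set 0]) w -> F w = lambda *: e + w -> w <> v ->
  forall eta : R, 0 < eta ->
  exists y, [/\ psi y = 0, 2^-1 <= `|y| <= 1 & `|y - h y| <= eta].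
Proof.
move=> Gopen F_nexp [Gv v0] Fv [_ _ hhom hlo] hmono hsub [Gw w0] Fw wv eta eta0.
rewrite /= in v0 w0.
have pe := positive_form_unit.
pose d := om (w - v).
have d0 : 0 < d.
  apply: lt_le_trans (norm_le_omega _); last by rewrite linearB /= w0 v0 subrr.
  by rewrite normr_gt0 subr_eq0; apply/eqP.
(* Four errors of size [eta' * r] add up: two bound [u - h u + mu x *: e], and removing the multiple
   of [e] costs the same again. *)
pose eta' := eta / 4.
have eta'0 : 0 < eta' by rewrite divr_gt0.
have [r [r0 rd rG rho_le]] : exists r : R, [/\ 0 < r, r <= d,
    forall x, `|x - v| <= r -> G x &
    forall u, `|u| <= r -> `|F (v + u) - (v + h u)| <= eta' * `|u|].
  have /eqoP/(_ eta' eta'0)/nbhs_ballP[r1 /= r10 Hr1] := hlo.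
  have /nbhs_ballP[r2 /= r20 Hr2] := open_nbhs_nbhs (conj Gopen Gv).
  (* Halving puts the closed ball of radius [r] inside the open balls of radii [r1] and [r2]. *)
  exists (Num.min d (Num.min r1 r2 / 2)).
  have m0 : 0 < Num.min r1 r2 by rewrite lt_min r10 r20.
  split.
  - by rewrite lt_min d0 divr_gt0.
  - by rewrite ge_min lexx.
  - move=> x; rewrite le_min => /andP[_ xr]; apply: Hr2.
    rewrite -ball_normE /= distrC.
    have : Num.min r1 r2 <= r2 by rewrite ge_min lexx orbT.
    lra.
  - move=> u; rewrite le_min => /andP[_ ur].
    have := Hr1 u; rewrite Fv; apply.
    rewrite -ball_normE /= sub0r normrN.
    have : Num.min r1 r2 <= r1 by rewrite ge_min lexx.
    lra.
(* This multiple of [e] is the one whose removal puts [F x] in [psi^-1(0)]. *)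
pose mu x := psi (F x) / psi e.
pose f x := F x - mu x *: e.
have psif x : psi (f x) = 0.
  by rewrite /f linearB positive_formZ /mu divfK ?subrr// gt_eqF.
have omf x y : om (f x - f y) = om (F x - F y).
  rewrite /f opprB addrACA [- _ - F y]addrC addrACA -scalerBl.
  exact: omegaDunit.
have fv : f v = v by rewrite /f /mu Fv v0 mul0r scale0r subr0.
have fw : f w = w.
  rewrite /f /mu Fw linearD /= positive_formZ w0 addr0 mulfK ?gt_eqF//.
  by rewrite addrAC subrr add0r.
pose S := [set x | [/\ psi x = 0, om (x - v) <= r & om (x - w) <= d - r]].
(* The ball around [v] alone keeps [S] inside [G], which may fail to contain the segment from [v] to
   [w]. *)
have SG x : S x -> (G `&` psi @^-1` [set 0]) x.
  move=> [x0 xv _]; split => //; apply: rG; apply: le_trans xv.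
  by apply: norm_le_omega; rewrite linearB /= x0 v0 subrr.
have f_nexp x y : S x -> S y -> om (f x - f y) <= om (x - y).
  by move=> /SG Sx /SG Sy; rewrite omf; exact: F_nexp.
have convex_ball (c : X) (b : R) x y (t : R) : 0 <= t <= 1 ->
    om (x - c) <= b -> om (y - c) <= b ->
    om ((1 - t) *: x + t *: y - c) <= b.
  move=> t01 xb yb.
  have -> : (1 - t) *: x + t *: y - c = (1 - t) *: (x - c) + t *: (y - c).
    by rewrite !scalerBr addrACA -opprD -scalerDl subrK scale1r.
  apply: le_trans (omegaD _ _) _; rewrite !omegaZ !ger0_norm; nra.
have [x [x0 xv xw] xf] : exists2 x, S x & om (x - f x) < eta' * r.
  (* The starting point lies on the segment from [v] to [w] at [omega]-distance [r] from [v].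
     Stability of [S] comes from nonexpansiveness against the fixed points [v] and [w]. *)
  apply: (@approximate_fixed_point _ _ _ S f (v + (r / d) *: (w - v)) (2 * r)).
  - exact: omegaD.
  - exact: omegaZ.
  - move=> x y t t01 [x0 xv xw] [y0 yv yw]; split; try exact: convex_ball.
    by rewrite linearD !positive_formZ x0 y0 !mulr0 addr0.
  - move=> x Sx; have [x0 xv xw] := Sx; split => //.
    + rewrite -[in X in _ - X]fv omf; apply: le_trans xv.
      by apply: F_nexp; first exact: SG.
    + rewrite -[in X in _ - X]fw omf; apply: le_trans xw.
      by apply: F_nexp; first exact: SG.
  - exact: f_nexp.
  - move=> x y [_ xv _] [_ yv _]; rewrite -(subrKA v x).
    apply: le_trans (omegaD _ _) _.
    rewrite -[omega e (v - y)]omegaN opprB; lra.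
  - split.
    + by rewrite linearD positive_formZ linearB /= v0 w0 subrr mulr0 addr0.
    + rewrite addrAC subrr add0r omegaZ ger0_norm.
        by rewrite divfK// gt_eqF.
      by rewrite divr_ge0// ltW.
    + have -> : v + (r / d) *: (w - v) - w = (r / d - 1) *: (w - v).
        by rewrite scalerBl scale1r opprB addrCA addrA [v + _ - w]addrAC.
      rewrite omegaZ -/d ler0_norm.
        by rewrite opprB mulrBl mul1r divfK ?lexx// gt_eqF.
      by rewrite subr_le0 ler_pdivrMr// mul1r.
  - by rewrite mulr_gt0.
pose u := x - v.
have u0 : psi u = 0 by rewrite linearB /= x0 v0 subrr.
have ur : om u = r.
  apply/eqP; rewrite eq_le xv /=.
  (* Since [om (w - x) <= d - r], the triangle inequality gives [r <= om u]. *)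
  have : d <= om (w - x) + om u by rewrite /d -(subrKA x w); exact: omegaD.
  by rewrite -[om (w - x)]omegaN opprB; lra.
have unorm : `|u| <= r by rewrite -ur; exact: norm_le_omega.
have unorm' : r <= 2 * `|u| by rewrite -ur; exact: omega_le_norm.
have xf' : `|x - f x| <= eta' * r.
  apply: ltW; apply: le_lt_trans (norm_le_omega _) xf.
  by rewrite linearB /= psif x0 subrr.
have uh : `|u - h u + mu x *: e| <= 2 * (eta' * r).
  have -> : u - h u + mu x *: e = (x - f x) + (F (v + u) - (v + h u)).
    rewrite /u [v + (x - v)]addrC subrK /f -/u.
    have alg (a b c k m : X) : a - b - k + m = a - (c - m) + (c - (b + k)).
      by rewrite opprB [a + (m - c)]addrA [a + m - c + _]addrA subrK opprD !addrA
        [a - b - k + m]addrAC [a - b + m]addrAC.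
    exact: alg.
  apply: le_trans (ler_normD _ _) _.
  have := rho_le u unorm; nra.
have mu_le := approx_eigenvalue_small hmono hsub
  (positively_homogeneous0 hhom) u0 uh.
have uh' : `|u - h u| <= eta * r.
  have -> : u - h u = (u - h u + mu x *: e) - mu x *: e by rewrite addrK.
  apply: le_trans (ler_normB _ _) _.
  have := norm_unitZ (mu x); rewrite /eta' in uh mu_le *; lra.
have rV0 : 0 < r^-1 by rewrite invr_gt0.
(* This vector has [omega] equal to [1], hence norm between [1/2] and [1]; homogeneity of [h]
   rescales the error. *)
exists (r^-1 *: u); split.
- by rewrite positive_formZ u0 mulr0.
- rewrite normrZ gtr0_norm// mulrC ler_pdivlMr// ler_pdivrMr// mul1r.
  by rewrite unorm andbT; lra.
- by rewrite hhom// -scalerBr normrZ gtr0_norm// mulrC ler_pdivrMr.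
Qed.

End AMUnit.

(** * From almost zeros to a zero by Property (F) *)

(** Almost zeros with errors tending to [0] form a bounded sequence. Closedness of [D], the lower
    bound on the norms and continuity of [g] all pass to the limit of a convergent subsequence. *)
Lemma property_F_zero {R : realType} {X Y : completeNormedModType R}
    (D : set X) (g : X -> Y) (c C : R) :
  closed D -> continuous g -> property_F D g ->
  (forall eta : R, 0 < eta ->
    exists y, [/\ D y, c <= `|y| <= C & `|g y| <= eta]) ->
  exists l, [/\ D l, c <= `|l| & g l = 0].
Proof.
move=> Dclosed gcont gF approx.
have /choice[u Hu] (n : nat) :
    exists y, [/\ D y, c <= `|y| <= C & `|g y| <= n.+1%:R^-1].
  exact: approx.
(* Used twice: with [s = id] to apply Property (F), then with the extracted subsequence. *)
have to0 (s : nat -> nat) : (forall n, (n <= s n)%N) ->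
    g (u (s n)) @[n --> \oo] --> (0 : Y).
  move=> s_ge; apply/cvgrPdist_le => eps eps0; near=> n.
  rewrite sub0r normrN.
  have [_ _ /le_trans] := Hu (s n); apply.
  apply: (@le_trans _ _ n.+1%:R^-1).
    by rewrite lef_pV2 ?posrE// ler_nat ltnS.
  by apply: ltW; near: n; exact: near_infty_natSinv_lt (PosNum eps0).
have [] := gF u _ _ (to0 id (fun n => leqnn n)).
- by move=> n; have [] := Hu n.
- exists C; split; first exact: num_real.
  move=> M CM n _ /=; have [_ /andP[_ uC] _] := Hu n.
  exact: le_trans uC (ltW CM).
move=> s s_inc /cvg_ex[/= l ul].
have s_ge n : (n <= s n)%N.
  elim: n => // n IH; apply: leq_ltn_trans IH _.
  by have := s_inc n.+1 n; rewrite ltnn leEnat => /negbT; rewrite -ltnNge.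
exists l; split.
- apply: closed_cvg Dclosed _ _ ul.
  by apply: nearW => n; have [] := Hu (s n).
- have nl : (fun n => `|u (s n)|) @ \oo --> `|l| by exact: cvg_norm ul.
  rewrite -(cvg_lim _ nl)//; apply: limr_ge; first by apply/cvg_ex; exists `|l|.
  by apply: nearW => n; have [_ /andP[]] := Hu (s n).
- have gl : g (u (s n)) @[n --> \oo] --> g l.
    exact: (cvg_comp _ _ ul (gcont l)).
  exact: cvg_unique gl (to0 s s_ge).
Unshelve. all: by end_near. Qed.

Theorem corollary10p3 (R : realType) (X : banachLatticeType R) (e : X)
  (he : is_am_unit e)
  (psi : {linear X -> R^o}) (hpsi : positive_form psi)
  (hpsi0 : exists x : X, psi x <> 0)
  (G : set X) (hG : open G) (F : X -> X)
  (hF : nonexpansive_on (G `&` psi @^-1` [set 0]) (omega e) F)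
  (v : X) (hvG : (G `&` psi @^-1` [set 0]) v) (hv : F v = v)
  (F'v : X -> X)
  (A1 : is_semidifferential G F v F'v)
  (A2 : property_F (psi @^-1` [set 0]) (fun x => x - F'v x))
  (A3 : forall x : X, (psi @^-1` [set 0]) x -> F'v x = x -> x = 0)
  (A4 : order_preserving F'v)
  (A5 : additively_subhomogeneous e F'v)
  (w : X) (hw : (G `&` psi @^-1` [set 0]) w)
  (lambda : R) (hlambda : F w = lambda *: e + w) :
  w = v.
Proof.
apply: contrapT => wv.
have [_ hcont _ _] := A1.
(* The zero [l] has norm at least [1/2], while (A3) forces [l = 0]. *)
have [|||l [l0 l_ge lfix]] := @property_F_zero _ _ _ _ _ 2^-1 1 _ _ A2.
- apply: (@closed_comp _ _ psi [set 0]); last first.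
    exact/accessible_closed_set1/hausdorff_accessible/Rhausdorff.
  by move=> x _; exact: hpsi.1.
- by move=> x; apply: cvgB => //; exact: hcont.
- exact: (approx_fixed_direction he hpsi hpsi0 hG hF hvG hv A1 A4 A5 hw hlambda).
have /A3 : F'v l = l by apply/eqP; rewrite eq_sym -subr_eq0 lfix.
move=> /(_ l0) l_0; move: l_ge; rewrite l_0 normr0; lra.
Qed.
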